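(* Consider a linear ($\alpha=+\infty$) or quasi-linear ($\alpha=1$) Fisher market as in the context. Let $\mu\in\mathbb R^m$ be an output of APM that satisfies the stopping criterion, where the accuracy satisfies $\epsilon\le\log(m+1)\|B\|_1$. Let $p_j=\exp(\mu_j)$ for $j\in[m]$ and let $x\in\mathbb R^{n\times m}_+$ be given by $$x_{ij}=\frac{B_i}{p_j}\cdot\frac{\exp\big(\frac{\log(v_{ij})-\mu_j}{\delta}\big)}{\sum_{k\in\{0\}\cup[m]}\exp\big(\frac{\log(v_{ik})-\mu_k}{\delta}\big)},\qquad i\in[n],\ j\in[m].$$ Then: (B1) $\sum_{j\in[m]}p_jx_{ij}\le B_i$ for all $i\in[n]$; (B2) $u_i(x_i)+\alpha^{-1}B_i\ge\Big(1-\frac{2\epsilon}{\|B\|_1}\Big)\max_{x_i'\in\mathbb R^m_+}\Big\{u_i(x_i')+\alpha^{-1}B_i:\ \sum_{j\in[m]}p_jx_{ij}'\le B_i\Big\}$ for all $i\in[n]$; (B3) $\big|\sum_{i\in[n]}x_{ij}-1\big|\le\epsilon$ for all $j\in[m]$.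
   Context: Market. There are $m\ge1$ goods and $n\ge1$ buyers; $[m]=\{1,\dots,m\}$. Buyer $i$ has budget $B_i>0$, $B=(B_1,\dots,B_n)$, and the utility matrix $v=(v_{ij})\in\mathbb R^{n\times m}$ has nonnegative entries and no zero row or zero column; $v_i$ is the $i$-th row. A parameter $\alpha\in\{1,+\infty\}$ selects the utility of an allocation vector $x_i\in\mathbb R^m_+$: $u_i(x_i)=\sum_{j\in[m]}v_{ij}x_{ij}$ (linear) if $\alpha=+\infty$, and $u_i(x_i)=\sum_{j\in[m]}(v_{ij}-p_j)x_{ij}$ (quasi-linear, at prices $p$) if $\alpha=1$. Conventions: $\alpha^{-1}=0$ if $\alpha=+\infty$; $v_{i0}=1$ for all $i$; $\mu_0=\log\alpha\in\{0,+\infty\}$; $\log0=-\infty$; $\exp(-\infty)=0$. Bounds. $\bar p=(1-\alpha^{-1})\|B\|_1+\max_{i\in[n],j\in[m]}\alpha^{-1}v_{ij}$, $\ \underline p=\min_{j\in[m]}\max_{i\in[n]}\frac{v_{ij}B_i}{\|v_i\|_1+\alpha^{-1}B_i}$, $\ \underline\mu=\log\underline p$, $\ \bar\mu=\log\bar p$. Smoothed objective. For $\delta>0$, $$F_\delta(\mu)=\sum_{j\in[m]}\exp(\mu_j)+\delta\sum_{i\in[n]}B_i\log\Big(\sum_{j\in\{0\}\cup[m]}\exp\big(\tfrac{\log(v_{ij})-\mu_j}{\delta}\big)\Big).$$ APM with accuracy $\epsilon\in(0,\exp(\underline\mu-1)]$. Parameters: $\delta=\epsilon/(2\log(m+1)\|B\|_1)$,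 $\eta=1$, $L=\exp(\bar\mu+\eta)+\|B\|_1/\delta$, $\sigma=\exp(\underline\mu-\eta)$, $q=\sigma/L$. Initialization: $\mu^0\in[\underline\mu,\bar\mu]^m$, $y^0=\mu^0$. Iteration: $\mu^{t+1}_j=\max\{\underline\mu-\eta,\min\{y^t_j-\frac1L\nabla_jF_\delta(y^t),\bar\mu+\eta\}\}$ for $j\in[m]$, and $y^{t+1}=\mu^{t+1}+\frac{1-\sqrt q}{1+\sqrt q}(\mu^{t+1}-\mu^t)$. In particular all iterates $\mu^t$ lie in $[\underline\mu-\eta,\bar\mu+\eta]^m$. Stopping criterion, upon which $\mu^t$ is output: $\|\nabla F_\delta(\mu^t)\|_2\le\min\{\sigma\epsilon,\sqrt{\sigma\epsilon}\}$. The $\delta$ in the definition of $x$ is the parameter $\delta$ of APM. *)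

(* Defs.v *)
From HB Require Import structures.
From mathcomp Require Import all_boot all_order all_algebra.
From mathcomp Require Import all_classical all_reals all_analysis.

Set Implicit Arguments.
Unset Strict Implicit.
Unset Printing Implicit Defensive.

Import Order.TTheory GRing.Theory Num.Theory.
Import numFieldNormedType.Exports.

Local Open Scope classical_set_scope.
Local Open Scope ring_scope.

Definition l1norm (R : realType) (k : nat) (w : 'rV[R]_k) : R :=
  \sum_(j < k) `|w 0 j|.

Definition l2norm (R : realType) (k : nat) (w : 'rV[R]_k) : R :=
  Num.sqrt (\sum_(j < k) w 0 j ^+ 2).

Definition gradient (R : realType) (k : nat) (f : 'rV[R]_k -> R)
    (a : 'rV[R]_k) : 'rV[R]_k :=
  \row_(j < k) 'D_(delta_mx 0 j) f a.

Definition is_max (R : realType) (S : set R) (M : R) : Prop :=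
  S M /\ ubound S M.

(* alpha^-1 as a real number: [inve] sends +oo to 0. *)
Definition alpha_inv (R : realType) (alpha : \bar R) : R := fine (alpha^-1)%E.

Definition utility (R : realType) (m : nat) (alpha : \bar R)
    (vi p xi : 'rV[R]_m) : R :=
  if alpha == +oo%E then \sum_(j < m) vi 0 j * xi 0 j
  else \sum_(j < m) (vi 0 j - p 0 j) * xi 0 j.

Definition budget_set (R : realType) (m : nat) (p : 'rV[R]_m) (b : R) :
    set 'rV[R]_m :=
  [set xi | (forall j, 0 <= xi 0 j) /\ \sum_(j < m) p 0 j * xi 0 j <= b].

(* exp ((log w - s) / delta), computed in the extended reals, so that
   lne 0 = -oo, lne +oo = +oo and expeR -oo = 0.  In all uses the value is
   finite: w is a nonnegative real, and s is finite or, for the outside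
   option, w = 1 and s = lne alpha is 0 or +oo. *)
Definition weight (R : realType) (delta w : R) (s : \bar R) : R :=
  fine (expeR ((lne w%:E - s) * (delta^-1)%:E)%E).

(* The sum over k in {0} U [m]; the first summand is k = 0, with v_i0 = 1 and
   mu_0 = log alpha. *)
Definition total_weight (R : realType) (m : nat) (alpha : \bar R) (delta : R)
    (vi mu : 'rV[R]_m) : R :=
  weight delta 1 (lne alpha)
  + \sum_(k < m) weight delta (vi 0 k) (mu 0 k)%:E.

Definition smoothed_objective (R : realType) (m n : nat) (alpha : \bar R)
    (B : 'rV[R]_n) (v : 'M[R]_(n, m)) (delta : R) (mu : 'rV[R]_m) : R :=
  \sum_(j < m) expR (mu 0 j)
  + delta * \sum_(i < n) B 0 i * ln (total_weight alpha delta (row i v) mu).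

(* Maxima of nonnegative numbers, hence the default value 0. *)
Definition p_upper (R : realType) (m n : nat) (alpha : \bar R)
    (B : 'rV[R]_n) (v : 'M[R]_(n, m)) : R :=
  (1 - alpha_inv alpha) * l1norm B
  + \big[Num.max/0]_(i < n) \big[Num.max/0]_(j < m) (alpha_inv alpha * v i j).

(* The minimum is taken in \bar R, where +oo is neutral; it is finite when
   0 < m. *)
Definition p_lower (R : realType) (m n : nat) (alpha : \bar R)
    (B : 'rV[R]_n) (v : 'M[R]_(n, m)) : R :=
  fine (\big[Order.min/+oo%E]_(j < m)
    (\big[Num.max/0]_(i < n)
       (v i j * B 0 i / (l1norm (row i v) + alpha_inv alpha * B 0 i)))%:E).

Definition mu_upper (R : realType) (m n : nat) (alpha : \bar R)
    (B : 'rV[R]_n) (v : 'M[R]_(n, m)) : R := ln (p_upper alpha B v).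

Definition mu_lower (R : realType) (m n : nat) (alpha : \bar R)
    (B : 'rV[R]_n) (v : 'M[R]_(n, m)) : R := ln (p_lower alpha B v).

Definition apm_delta (R : realType) (m n : nat) (B : 'rV[R]_n) (eps : R) : R :=
  eps / (2 * ln (m.+1%:R) * l1norm B).

Definition apm_eta (R : realType) : R := 1.

Definition apm_L (R : realType) (m n : nat) (alpha : \bar R)
    (B : 'rV[R]_n) (v : 'M[R]_(n, m)) (eps : R) : R :=
  expR (mu_upper alpha B v + apm_eta R) + l1norm B / apm_delta m B eps.

Definition apm_sigma (R : realType) (m n : nat) (alpha : \bar R)
    (B : 'rV[R]_n) (v : 'M[R]_(n, m)) : R :=
  expR (mu_lower alpha B v - apm_eta R).

Definition apm_q (R : realType) (m n : nat) (alpha : \bar R)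
    (B : 'rV[R]_n) (v : 'M[R]_(n, m)) (eps : R) : R :=
  apm_sigma alpha B v / apm_L alpha B v eps.

Definition apm_gradient (R : realType) (m n : nat) (alpha : \bar R)
    (B : 'rV[R]_n) (v : 'M[R]_(n, m)) (eps : R) (y : 'rV[R]_m) : 'rV[R]_m :=
  gradient (smoothed_objective alpha B v (apm_delta m B eps)) y.

Definition apm_init (R : realType) (m n : nat) (alpha : \bar R)
    (B : 'rV[R]_n) (v : 'M[R]_(n, m)) (mu0 : 'rV[R]_m) : Prop :=
  forall j, mu_lower alpha B v <= mu0 0 j <= mu_upper alpha B v.

(* One iteration on the pair (mu^t, y^t). *)
Definition apm_step (R : realType) (m n : nat) (alpha : \bar R)
    (B : 'rV[R]_n) (v : 'M[R]_(n, m)) (eps : R)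
    (s : 'rV[R]_m * 'rV[R]_m) : 'rV[R]_m * 'rV[R]_m :=
  let: (mu, y) := s in
  let g := apm_gradient alpha B v eps y in
  let L := apm_L alpha B v eps in
  let r := Num.sqrt (apm_q alpha B v eps) in
  let mu' := \row_(j < m)
    Num.max (mu_lower alpha B v - apm_eta R)
      (Num.min (y 0 j - L^-1 * g 0 j) (mu_upper alpha B v + apm_eta R)) in
  (mu', mu' + ((1 - r) / (1 + r)) *: (mu' - mu)).

Definition apm_iterate (R : realType) (m n : nat) (alpha : \bar R)
    (B : 'rV[R]_n) (v : 'M[R]_(n, m)) (eps : R) (mu0 : 'rV[R]_m) (t : nat) :
    'rV[R]_m :=
  (iter t (apm_step alpha B v eps) (mu0, mu0)).1.

Definition apm_stop (R : realType) (m n : nat) (alpha : \bar R)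
    (B : 'rV[R]_n) (v : 'M[R]_(n, m)) (eps : R) (mu : 'rV[R]_m) : Prop :=
  let sigma := apm_sigma alpha B v in
  l2norm (apm_gradient alpha B v eps mu)
    <= Num.min (sigma * eps) (Num.sqrt (sigma * eps)).

(* Any iterate meeting the stopping criterion counts as an output, in
   particular the first one. *)
Definition apm_output (R : realType) (m n : nat) (alpha : \bar R)
    (B : 'rV[R]_n) (v : 'M[R]_(n, m)) (eps : R) (mu : 'rV[R]_m) : Prop :=
  exists mu0 t, [/\ apm_init alpha B v mu0,
    mu = apm_iterate alpha B v eps mu0 t & apm_stop alpha B v eps mu].

(* Main.v *)
Require Import Defs.
From HB Require Import structures.
From mathcomp Require Import all_boot all_order all_algebra.
From mathcomp Require Import all_classical all_reals all_analysis.
From mathcomp Require Import ring lra.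

Set Implicit Arguments.
Unset Strict Implicit.
Unset Printing Implicit Defensive.

Import Order.TTheory GRing.Theory Num.Theory.
Import numFieldNormedType.Exports.

Local Open Scope classical_set_scope.
Local Open Scope ring_scope.

(** At prices [p], money that buyer [i] spends on good [j] is turned into
    utility at the rate [v i j / p j], and money kept is worth [alpha_inv alpha]
    per unit: 1 in the quasi-linear case, 0 in the linear case.  With keeping
    the money treated as one more option, both kinds of market become the same
    problem: [utility + alpha_inv alpha * b] is the sum of the rates weighted by
    a split of the budget [b] among the [m.+1] options ([utility_spending]), so
    its maximum is [b] times the best rate ([is_max_money_rate]).

    The weights that define [x] are the powers [rate `^ delta^-1]
    ([weightE], [total_weightE]), so [x] splits the budget by a softmax of the
    logarithms of the rates with temperature [delta].  Hence:
    - no budget is exceeded because the share of the money kept is nonnegative;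
    - the bundles are almost optimal because a softmax average of [N] numbers
      loses at most the fraction [delta * ln N] of their maximum
      ([softmax_mean_ge]); with [N = m.+1] and the chosen [delta] this fraction
      is [eps / (2 * l1norm B)], a quarter of the loss allowed;
    - the goods are almost cleared because the [j]-th partial derivative of the
      smoothed objective is the price [p j] times the excess supply of good [j]
      ([gradient_smoothed_objective]): the stopping criterion bounds it by
      [sigma * eps], and the projection step of the method keeps
      [p j >= sigma] ([apm_iterate_ge]). *)

(** * The loss of a softmax average *)

(** The contribution of one option of rate [r] to the loss against a reference
    rate [M].  With [r = M * exp (- d z)], two uses of the tangent bound
    [1 + t <= expR t] give [M - r <= M d z] and [z <= c - 1 + exp (z - c)], and
    [exp z] is the ratio of the two powers.  The free shift [c] is what lets the
    terms [M `^ d^-1 * expR (- c)] of [N] options add up to a single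
    [M `^ d^-1], by taking [c = ln N]. *)
Lemma powR_softmax_loss (R : realType) (d c M r : R) :
  0 < d -> 0 < M -> 0 <= r ->
  r `^ d^-1 * (M - r)
    <= M * d * ((c - 1) * r `^ d^-1 + M `^ d^-1 * expR (- c)).
Proof.
move=> d0 M0; rewrite le_eqVlt => /predU1P[<-|r0].
  rewrite powR0 ?invr_eq0 ?gt_eqF// mul0r mulr0 add0r.
  by rewrite !mulr_ge0 ?powR_ge0 ?expR_ge0 ?ltW.
pose z := d^-1 * (ln M - ln r).
have rE : r = M * expR (- (d * z)).
  rewrite /z mulrA divff ?gt_eqF// mul1r opprB expRB !lnK ?posrE//.
  by rewrite mulrC divfK ?gt_eqF.
have -> : M `^ d^-1 = r `^ d^-1 * expR z.
  by rewrite /powR !gt_eqF// -expRD /z; congr expR; ring.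
have w0 := powR_gt0 d^-1 r0; move: (r `^ _) w0 => w w0.
have -> : M * d * ((c - 1) * w + w * expR z * expR (- c)) =
  w * (M * (d * (c - 1 + expR (z - c)))) by rewrite expRD; ring.
rewrite ler_pM2l// {1}rE -[X in X - _ <= _]mulr1 -mulrBr ler_pM2l//.
apply: (@le_trans _ _ (d * z)).
  by have := expR_ge1Dx (- (d * z)); lra.
by rewrite ler_pM2l//; have := expR_ge1Dx (z - c); lra.
Qed.

(** Summing the individual losses with [c = ln #|I|]: the [- r k `^ d^-1] parts
    add up to minus the total weight, which absorbs [r k0 `^ d^-1], one of its
    terms.  What remains is the fraction [d * ln #|I|] of [r k0] times the total
    weight. *)
Lemma softmax_mean_ge (R : realType) (I : finType) (d : R) (r : I -> R)
    (k0 : I) :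
  0 < d -> (forall k, 0 <= r k) ->
  (1 - d * ln #|I|%:R) * r k0 * (\sum_k r k `^ d^-1)
    <= \sum_k r k `^ d^-1 * r k.
Proof.
move=> d0 r0; have := r0 k0; rewrite le_eqVlt => /predU1P[<-|M0].
  by rewrite mulr0 mul0r sumr_ge0// => k _; rewrite mulr_ge0 ?powR_ge0.
have N0 : 0 < #|I|%:R :> R by rewrite ltr0n; apply/card_gt0P; exists k0.
pose M := r k0; pose c := ln (#|I|%:R : R).
have WT : M `^ d^-1 <= \sum_k r k `^ d^-1.
  by rewrite (bigD1 k0)//= lerDl sumr_ge0// => k _; exact: powR_ge0.
have : \sum_k r k `^ d^-1 * (M - r k) <=
    \sum_k M * d * ((c - 1) * r k `^ d^-1 + M `^ d^-1 * expR (- c)).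
  by apply: ler_sum => k _; exact: powR_softmax_loss.
rewrite -mulr_sumr big_split/= -mulr_sumr sumr_const expRN lnK ?posrE//.
rewrite -[_ *+ _]mulr_natr divfK ?gt_eqF//.
under eq_bigr do rewrite mulrBr.
rewrite sumrB -mulr_suml -/M -/c.
have : M * d * (M `^ d^-1) <= M * d * (\sum_k r k `^ d^-1).
  by rewrite ler_pM2l ?mulr_gt0.
move: (\sum_k r k `^ d^-1) (\sum_k r k `^ d^-1 * r k) (M `^ _) => T S W.
lra.
Qed.

(** * Utility as a return on money *)

Lemma sum_option (V : nmodType) (I : finType) (F : option I -> V) :
  \sum_k F k = F None + \sum_i F (Some i).
Proof.
rewrite (bigD1 None)//=; congr (_ + _).
rewrite (reindex_omap Some id)/=; last by case.
by apply: eq_bigl => i; rewrite eqxx.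
Qed.

(** [None] is the option of keeping the money. *)
Definition money_rate (R : realType) (m : nat) (alpha : \bar R)
    (vi p : 'rV[R]_m) (k : option 'I_m) : R :=
  if k is Some j then vi 0 j / p 0 j else alpha_inv alpha.

Definition spending (R : realType) (m : nat) (p : 'rV[R]_m) (b : R)
    (xi : 'rV[R]_m) (k : option 'I_m) : R :=
  if k is Some j then p 0 j * xi 0 j else b - \sum_(j < m) p 0 j * xi 0 j.

Lemma sum_spending (R : realType) (m : nat) (p : 'rV[R]_m) (b : R)
    (xi : 'rV[R]_m) : \sum_k spending p b xi k = b.
Proof. by rewrite sum_option /= subrK. Qed.

Lemma alpha_invy (R : realType) : alpha_inv (+oo%E : \bar R) = 0.
Proof. by rewrite /alpha_inv invey. Qed.

Lemma alpha_inv1 (R : realType) : alpha_inv (1%E : \bar R) = 1.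
Proof. by rewrite /alpha_inv inve1. Qed.

(** In the quasi-linear case the payment [p j] subtracted from the value of each
    unit and the constant [b] together make up the money kept. *)
Lemma utility_spending (R : realType) (m : nat) (alpha : \bar R)
    (vi p : 'rV[R]_m) (b : R) (xi : 'rV[R]_m) :
  alpha = 1%E \/ alpha = +oo%E -> (forall j, 0 < p 0 j) ->
  utility alpha vi p xi + alpha_inv alpha * b
    = \sum_k money_rate alpha vi p k * spending p b xi k.
Proof.
move=> halpha p0; rewrite sum_option/=.
have vE j : vi 0 j / p 0 j * (p 0 j * xi 0 j) = vi 0 j * xi 0 j.
  by rewrite mulrA divfK ?gt_eqF.
under [X in _ = _ + X]eq_bigr do rewrite vE.
case: halpha => ->; rewrite /utility/=.
  rewrite alpha_inv1 !mul1r; under eq_bigr do rewrite mulrBl.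
  by rewrite sumrB; ring.
by rewrite alpha_invy !mul0r addr0 add0r.
Qed.

(** An average of the rates is at most the best one, and spending the whole
    budget on a best option attains it. *)
Lemma is_max_money_rate (R : realType) (m : nat) (alpha : \bar R)
    (vi p : 'rV[R]_m) (b : R) (k0 : option 'I_m) :
  alpha = 1%E \/ alpha = +oo%E -> (forall j, 0 < p 0 j) -> 0 <= b ->
  (forall k, money_rate alpha vi p k <= money_rate alpha vi p k0) ->
  is_max [set utility alpha vi p xi + alpha_inv alpha * b
         | xi in budget_set p b] (money_rate alpha vi p k0 * b).
Proof.
move=> halpha p0 b0 k0max; split; last first.
  move=> _ [xi [xi0 xib] <-]; rewrite utility_spending//.
  rewrite -[X in _ <= _ * X](sum_spending p b xi) mulr_sumr.
  apply: ler_sum => k _; apply: ler_wpM2r => //.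
  by case: k => [j|]/=; [rewrite mulr_ge0// ltW|rewrite subr_ge0].
case: k0 {k0max} => [j|].
  have sE :
      \sum_(k < m) p 0 k * ((b / p 0 j) *: delta_mx 0 j : 'rV[R]_m) 0 k = b.
    rewrite (bigD1 j)//= !mxE !eqxx mulr1 mulrC divfK ?gt_eqF//.
    rewrite big1 ?addr0// => k kj.
    by rewrite !mxE (negbTE kj) andbF !mulr0.
  exists ((b / p 0 j) *: delta_mx 0 j).
    split; last by rewrite sE.
    by move=> k; rewrite !mxE mulr_ge0// divr_ge0// ltW.
  rewrite utility_spending// sum_option/= sE subrr mulr0 add0r (bigD1 j)//=.
  rewrite !mxE !eqxx mulr1 [p 0 j * _]mulrC divfK ?gt_eqF//.
  rewrite big1 ?addr0// => k kj.
  by rewrite !mxE (negbTE kj) andbF !mulr0.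
have p0x j : p 0 j * (0 : 'rV[R]_m) 0 j = 0 by rewrite mxE mulr0.
have s0 : \sum_(j < m) p 0 j * (0 : 'rV[R]_m) 0 j = 0 by rewrite big1.
exists 0; first by split=> [j|]; rewrite ?mxE ?s0.
rewrite utility_spending// sum_option/= s0 subr0 big1 ?addr0// => j _.
by rewrite p0x mulr0.
Qed.

(** * The weights as powers of the rates *)

(** Valid also for [w = 0]: the value [expeR -oo = 0] of the weight agrees with
    the convention [0 `^ t = 0] for [t != 0]. *)
Lemma weightE (R : realType) (d w s : R) : 0 < d -> 0 <= w ->
  weight d w s%:E = (w / expR s) `^ d^-1.
Proof.
move=> d0; rewrite /weight le_eqVlt => /predU1P[<-|w0].
  rewrite /= lexx mul0r powR0 ?invr_eq0 ?gt_eqF//.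
  by rewrite gt0_mulNye// lte_fin invr_gt0.
rewrite lne_EFin//= /powR gt_eqF ?divr_gt0 ?expR_gt0//.
by rewrite ln_div ?posrE ?expR_gt0// expRK mulrC.
Qed.

Lemma weight_outside (R : realType) (alpha : \bar R) (d : R) :
  alpha = 1%E \/ alpha = +oo%E -> 0 < d ->
  weight d 1 (lne alpha) = alpha_inv alpha `^ d^-1.
Proof.
move=> [] -> d0; first by rewrite lne1 weightE// expR0 divr1 alpha_inv1.
rewrite alpha_invy powR0 ?invr_eq0 ?gt_eqF// /weight lne1/=.
by rewrite gt0_mulNye// lte_fin invr_gt0.
Qed.

Lemma total_weightE (R : realType) (m : nat) (alpha : \bar R) (d : R)
    (vi mu p : 'rV[R]_m) :
  alpha = 1%E \/ alpha = +oo%E -> 0 < d -> (forall j, 0 <= vi 0 j) ->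
  (forall j, p 0 j = expR (mu 0 j)) ->
  total_weight alpha d vi mu = \sum_k money_rate alpha vi p k `^ d^-1.
Proof.
move=> halpha d0 vi0 pE; rewrite sum_option /total_weight weight_outside//.
by congr (_ + _); apply: eq_bigr => j _; rewrite weightE//= pE.
Qed.

Lemma total_weight_gt0 (R : realType) (m : nat) (alpha : \bar R) (d : R)
    (vi mu : 'rV[R]_m) :
  (forall j, 0 <= vi 0 j) -> vi != 0 -> 0 < d ->
  0 < total_weight alpha d vi mu.
Proof.
move=> vi0 vin0 d0.
have [j vij] : exists j, vi 0 j != 0.
  apply/existsP; apply: contraR vin0; rewrite negb_exists => /forallP h.
  by apply/eqP/rowP => j; rewrite mxE; apply/eqP/negPn/h.
have weight_ge0 w s : 0 <= weight d w s by rewrite fine_ge0 ?expeR_ge0.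
rewrite /total_weight (bigD1 j)//= ltr_wpDl// ltr_pwDl ?sumr_ge0//.
by rewrite weightE// powR_gt0// divr_gt0 ?expR_gt0// lt_neqAle eq_sym vij vi0.
Qed.

(** * The gradient of the smoothed objective *)

(** Reduces a directional derivative to one real variable, where the chain rule
    applies. *)
Lemma derive_along (R : numFieldType) (V W : normedModType R) (f : V -> W)
    (a u : V) :
  'D_u f a = 'D_1 (fun h : R => f (a + h *: u)) 0.
Proof.
rewrite /derive; apply: (congr1 (fun q => lim (q @ 0^'))).
apply/funext => h /=.
by rewrite addr0 scale0r addr0 [h *: 1]mulr1 [h *: u + a]addrC.
Qed.

Lemma weight_shift (R : realType) (d w s h : R) : 0 < d -> 0 <= w ->
  weight d w (s + h)%:E = weight d w s%:E * expR (- d^-1 * h).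
Proof.
move=> d0; rewrite le_eqVlt => /predU1P[<-|w0].
  by rewrite !weightE// !mul0r powR0 ?mul0r// invr_eq0 gt_eqF.
rewrite /weight lne_EFin//= -expRD; congr expR; ring.
Qed.

Lemma total_weight_shift (R : realType) (m : nat) (alpha : \bar R) (d : R)
    (vi mu : 'rV[R]_m) (j : 'I_m) (h : R) :
  0 < d -> (forall j, 0 <= vi 0 j) ->
  total_weight alpha d vi (mu + h *: delta_mx 0 j)
    = total_weight alpha d vi mu
      + weight d (vi 0 j) (mu 0 j)%:E * (expR (- d^-1 * h) - 1).
Proof.
move=> d0 vi0; rewrite /total_weight (bigD1 j)//= [in RHS](bigD1 j)//=.
rewrite !mxE !eqxx mulr1 weight_shift//.
under eq_bigr => k kj do rewrite !mxE (negbTE kj) andbF mulr0 addr0.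
ring.
Qed.

Lemma smoothed_objective_shift (R : realType) (m n : nat) (alpha : \bar R)
    (B : 'rV[R]_n) (v : 'M[R]_(n, m)) (d : R) (mu : 'rV[R]_m) (j : 'I_m)
    (h : R) :
  0 < d -> (forall i j, 0 <= v i j) ->
  smoothed_objective alpha B v d (mu + h *: delta_mx 0 j) =
    \sum_(k < m) expR (mu 0 k) + expR (mu 0 j) * (expR h - 1)
    + d * \sum_(i < n) B 0 i * ln (total_weight alpha d (row i v) mu
      + weight d (v i j) (mu 0 j)%:E * (expR (- d^-1 * h) - 1)).
Proof.
move=> d0 v0; rewrite /smoothed_objective; congr (_ + _ * _).
  rewrite (bigD1 j)//= [in RHS](bigD1 j)//=.
  rewrite !mxE !eqxx mulr1 expRD.
  under eq_bigr => k kj do rewrite !mxE (negbTE kj) andbF mulr0 addr0.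
  ring.
by apply: eq_bigr => i _; rewrite total_weight_shift ?mxE// => k; rewrite mxE.
Qed.

Lemma is_derive_ln_affine_expR (R : realType) (T w c : R) : 0 < T ->
  is_derive (0 : R) 1 (fun h : R => ln (T + w * (expR (c * h) - 1)))
    (c * (w / T)).
Proof.
move=> T0.
have lin : is_derive (0 : R) (1 : R) (fun h : R => c * h) c.
  have -> : (fun h : R => c * h) = c *: (@id R) by [].
  by apply: is_derive_eq; rewrite [_ *: 1]mulr1.
have expc : is_derive (0 : R) (1 : R) (fun h => expR (c * h)) c.
  have := @is_derive1_comp _ expR (fun h : R => c * h) 0 _ _
    (is_derive_expR _) lin.
  by rewrite mulr0 expR0 mul1r.
have inner : is_derive (0 : R) (1 : R)
    (fun h : R => T + w * (expR (c * h) - 1)) (c * w).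
  have -> : (fun h : R => T + w * (expR (c * h) - 1)) =
     cst T + w *: ((fun h => expR (c * h)) - cst 1) by [].
  have := is_deriveD (is_derive_cst T (0 : R) (1 : R))
    (is_deriveZ w (is_deriveB expc (is_derive_cst (1 : R) (0 : R) (1 : R)))).
  by rewrite add0r subr0 [_ *: _]mulrC.
have inner0 : T + w * (expR (c * 0) - 1) = T.
  by rewrite mulr0 expR0 subrr mulr0 addr0.
have outer : is_derive (T + w * (expR (c * 0) - 1)) 1 (@ln R) T^-1.
  by rewrite inner0; exact: is_derive1_ln.
have := @is_derive1_comp _ _ (fun h : R => T + w * (expR (c * h) - 1)) 0 _ _
  outer inner.
by have -> : T^-1 * (c * w) = c * (w / T) by ring.
Qed.

(** The factor [d] in front of the logarithms cancels the [- d^-1] of the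
    exponents, so that the sum is the money that the buyers spend on good [j]. *)
Lemma gradient_smoothed_objective (R : realType) (m n : nat) (alpha : \bar R)
    (B : 'rV[R]_n) (v : 'M[R]_(n, m)) (d : R) (mu : 'rV[R]_m) (j : 'I_m) :
  0 < d -> (forall i j, 0 <= v i j) -> (forall i, row i v != 0) ->
  gradient (smoothed_objective alpha B v d) mu 0 j =
  expR (mu 0 j) - \sum_(i < n) B 0 i *
    (weight d (v i j) (mu 0 j)%:E / total_weight alpha d (row i v) mu).
Proof.
move=> d0 v0 row0; rewrite mxE derive_along.
pose T i := total_weight alpha d (row i v) mu.
pose w i := weight d (v i j) (mu 0 j)%:E.
have T0 i : 0 < T i by apply: total_weight_gt0 => // k; rewrite mxE.
have -> :
  (fun h : R => smoothed_objective alpha B v d (mu + h *: delta_mx 0 j)) =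
  cst (\sum_(k < m) expR (mu 0 k)) + expR (mu 0 j) *: (expR - cst 1)
  + d *: \sum_(i < n)
      B 0 i *: (fun h => ln (T i + w i * (expR (- d^-1 * h) - 1))).
  apply/funext => h; rewrite smoothed_objective_shift//.
  by rewrite /= !fctE fct_sumE.
have D i : is_derive (0 : R) 1
    (fun h => ln (T i + w i * (expR (- d^-1 * h) - 1))) (- d^-1 * (w i / T i)).
  exact: is_derive_ln_affine_expR.
have prices := is_deriveD
  (is_derive_cst (\sum_(k < m) expR (mu 0 k)) (0 : R) (1 : R))
  (is_deriveZ (expR (mu 0 j))
    (is_deriveB (is_derive_expR (0 : R))
      (is_derive_cst (1 : R) (0 : R) (1 : R)))).
have logs := is_deriveZ d (is_derive_sum (fun i => is_deriveZ (B 0 i) (D i))).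
rewrite (@derive_val _ _ _ _ _ _ _ (is_deriveD prices logs)).
rewrite expR0 add0r subr0 [_ *: 1]mulr1; congr (_ + _).
rewrite scaler_sumr -sumrN; apply: eq_bigr => i _.
rewrite -/(T i) -/(w i); move: (w i / T i) => q; rewrite /GRing.scale/=.
by field; rewrite gt_eqF.
Qed.

(** * The iterates and the stopping criterion *)

Lemma ler_coord_l2norm (R : realType) (k : nat) (w : 'rV[R]_k) (j : 'I_k) :
  `|w 0 j| <= l2norm w.
Proof.
rewrite -sqrtr_sqr ler_sqrt ?sumr_ge0// => [|i _]; last exact: sqr_ge0.
by rewrite (bigD1 j)//= lerDl sumr_ge0// => i _; exact: sqr_ge0.
Qed.

(** Each step clamps the iterate to the box, and the starting point lies in the
    smaller box without the margin [apm_eta]. *)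
Lemma apm_iterate_ge (R : realType) (m n : nat) (alpha : \bar R)
    (B : 'rV[R]_n) (v : 'M[R]_(n, m)) (eps : R) (mu0 : 'rV[R]_m) (t : nat)
    (j : 'I_m) :
  apm_init alpha B v mu0 ->
  mu_lower alpha B v - apm_eta R <= apm_iterate alpha B v eps mu0 t 0 j.
Proof.
move=> init; rewrite /apm_iterate; case: t => [|t].
  by have /andP[+ _] := init j; rewrite /apm_eta/=; lra.
by rewrite iterS; case: (iter t _ _) => mu y; rewrite /= mxE le_max lexx.
Qed.

(** * Approximate equilibrium *)

Theorem proposition4p1 (R : realType) (m n : nat)
    (hm : (1 <= m)%N) (hn : (1 <= n)%N)
    (alpha : \bar R) (halpha : alpha = 1%E \/ alpha = +oo%E)
    (B : 'rV[R]_n) (hB : forall i, 0 < B 0 i)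
    (v : 'M[R]_(n, m)) (hv : forall i j, 0 <= v i j)
    (hrow : forall i, row i v != 0) (hcol : forall j, col j v != 0)
    (eps : R) (heps0 : 0 < eps)
    (heps1 : eps <= expR (mu_lower alpha B v - 1))
    (heps2 : eps <= ln (m.+1%:R) * l1norm B)
    (mu : 'rV[R]_m) (hmu : apm_output alpha B v eps mu)
    (p : 'rV[R]_m) (hp : forall j, p 0 j = expR (mu 0 j))
    (x : 'M[R]_(n, m))
    (hx : forall i j,
       x i j = B 0 i / p 0 j
               * (weight (apm_delta m B eps) (v i j) (mu 0 j)%:E
                  / total_weight alpha (apm_delta m B eps) (row i v) mu)) :
  [/\ (forall i, \sum_(j < m) p 0 j * x i j <= B 0 i),
      (forall i, exists2 M : R,
         is_max [set utility alpha (row i v) p xi + alpha_inv alpha * B 0 i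
                | xi in budget_set p (B 0 i)] M
         & utility alpha (row i v) p (row i x) + alpha_inv alpha * B 0 i
           >= (1 - 2 * eps / l1norm B) * M)
    & (forall j, `|\sum_(i < n) x i j - 1| <= eps)].
Proof.
set d := apm_delta m B eps in hx *.
have p0 j : 0 < p 0 j by rewrite hp expR_gt0.
have lnm0 : 0 < ln (m.+1%:R : R) by rewrite ln_gt0// ltr1n ltnS.
have B0 : 0 < l1norm B.
  rewrite /l1norm (bigD1 (Ordinal hn))//= ltr_pwDl ?normr_gt0 ?gt_eqF//.
  by rewrite sumr_ge0.
have d0 : 0 < d by rewrite divr_gt0 ?mulr_gt0.
have v0 i j : 0 <= row i v 0 j by rewrite mxE.
pose T i := total_weight alpha d (row i v) mu.
have T0 i : 0 < T i by exact: total_weight_gt0.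
pose r i := money_rate alpha (row i v) p.
have r0 i k : 0 <= r i k.
  case: k => [j|]; first by rewrite /r /= divr_ge0// ltW.
  by rewrite /r /=; case: halpha => ->; rewrite ?alpha_inv1 ?alpha_invy.
have TE i : T i = \sum_k r i k `^ d^-1 by exact: total_weightE.
have spendE i k :
    spending p (B 0 i) (row i x) k = B 0 i * (r i k `^ d^-1 / T i).
  have goodE j :
      p 0 j * row i x 0 j = B 0 i * (r i (Some j) `^ d^-1 / T i).
    rewrite mxE hx weightE// -hp mulrA; congr (_ * _).
      by rewrite mulrC divfK ?gt_eqF.
    by rewrite /r /= mxE.
  case: k => [j|/=]; first exact: goodE.
  under eq_bigr do rewrite goodE.
  (* The total weight includes the option None, which is what is left. *)
  rewrite -mulr_sumr -[X in X - _]mulr1 -mulrBr -mulr_suml; congr (_ * _).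
  have := TE i; rewrite sum_option => Ti.
  by rewrite -[1](@divff _ (T i)) ?gt_eqF// -mulrBl [X in X - _]Ti addrK.
split=> [i|i|j].
- have := spendE i None; rewrite /=.
  under eq_bigr => j _ do rewrite mxE.
  have : 0 <= B 0 i * (r i None `^ d^-1 / T i).
    by rewrite mulr_ge0 ?divr_ge0 ?powR_ge0 ?ltW.
  by move=> + e; rewrite -e subr_ge0.
- pose k0 := [arg max_(k > None) r i k]%O.
  have k0max k : r i k <= r i k0.
    by rewrite /k0; case: arg_maxP => // k' _; exact.
  exists (r i k0 * B 0 i); first by apply: is_max_money_rate => //; exact: ltW.
  rewrite utility_spending//; under eq_bigr do rewrite spendE.
  have dE : d * ln #|{: option 'I_m}|%:R = eps / (2 * l1norm B).
    rewrite card_option card_ord /d /apm_delta.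
    by field; rewrite !gt_eqF.
  have mean := softmax_mean_ge k0 d0 (r0 i); rewrite -TE dE in mean.
  have -> : \sum_k r i k * (B 0 i * (r i k `^ d^-1 / T i))
      = B 0 i * ((\sum_k r i k `^ d^-1 * r i k) / T i).
    by rewrite mulr_suml mulr_sumr; apply: eq_bigr => k _; ring.
  rewrite [leLHS]mulrA [leLHS]mulrC ler_pM2l// ler_pdivlMr//.
  apply: le_trans mean; rewrite ler_pM2r// ler_wpM2r// lerD2l lerN2.
  rewrite invfM mulrA ler_pM2r ?invr_gt0//; lra.
- have [mu0 [t [init muE stop]]] := hmu.
  have gradE : apm_gradient alpha B v eps mu 0 j
      = p 0 j * (1 - \sum_(i < n) x i j).
    rewrite /apm_gradient gradient_smoothed_objective// -hp mulrBr mulr1.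
    congr (_ - _); rewrite mulr_sumr; apply: eq_bigr => i _.
    by rewrite hx -/d; field; rewrite !gt_eqF//; exact: T0.
  have sigma_p : apm_sigma alpha B v <= p 0 j.
    by rewrite hp muE ler_expR; exact: apm_iterate_ge.
  have : `|apm_gradient alpha B v eps mu 0 j| <= apm_sigma alpha B v * eps.
    apply: le_trans (ler_coord_l2norm _ _) _; apply: le_trans stop _.
    by rewrite ge_min lexx.
  rewrite gradE normrM gtr0_norm// distrC => h.
  rewrite -(ler_pM2l (p0 j)); apply: le_trans h _.
  by rewrite ler_pM2r.
Qed.
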